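(* Let $\alpha<0$ and let $\mathcal{A}\neq0$ be a real antisymmetric $n\times n$ matrix. Let $\mathbf{X}(\varsigma)=(\mathbf{P}(\varsigma),\mathbf{T}(\varsigma))$ be an orbit in $\mathbb{B}^n\times\mathbb{S}^{n-1}$ of the compactified soliton flow. Then $\varsigma\mapsto V(\mathbf{X}(\varsigma))$ is either strictly increasing or constant along the entire orbit. If $V(\mathbf{X}(\varsigma))$ is constant, then either $\mathbf{X}$ corresponds to one of the trivial solitons (listed in the context), or the entire orbit $\mathbf{X}(\varsigma)$ consists of points at infinity, i.e. $\|\mathbf{P}(\varsigma)\|=1$ for all $\varsigma\in\mathbb{R}$.
   Context: For a nonzero vector $\mathbf{u}$, $\mathfrak{p}_{\mathbf{u}}(\mathbf{w})=\mathbf{w}-\frac{\langle\mathbf{w},\mathbf{u}\rangle}{\|\mathbf{u}\|^2}\mathbf{u}$. A rotating-dilating soliton is an arc length parametrized curve $\mathbf{C}:\mathbb{R}\to\mathbb{R}^n$ with $\mathbf{C}_{ss}=\mathfrak{p}_{\mathbf{C}_s}[(\alpha+\mathcal{A})\mathbf{C}]$ ($\alpha$ stands for $\alpha$ times the identity); write $\mathbf{T}=\mathbf{C}_s$. Setting $\mathbf{P}=\mathbf{C}/\sqrt{1+\|\mathbf{C}\|^2}$ and $d\varsigma=\sqrt{1+\|\mathbf{C}\|^2}\,ds$, solitons correspond to orbits with $\|\mathbf{P}\|<1$ of the compactified soliton flow \[ \mathbf{P}_\varsigma=(1-\|\mathbf{P}\|^2)(\mathbf{T}-\langle\mathbf{P},\mathbf{T}\rangle\mathbf{P}),\qquad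 \mathbf{T}_\varsigma=\mathfrak{p}_{\mathbf{T}}((\alpha+\mathcal{A})\mathbf{P}), \] which leaves the compact set $\mathbb{B}^n\times\mathbb{S}^{n-1}=\{(\mathbf{P},\mathbf{T}):\|\mathbf{P}\|\leq1,\|\mathbf{T}\|=1\}$ invariant. The function $V$ is $V=e^{\frac{\alpha}{2}\|\mathbf{C}\|^2}\langle\mathbf{T},\mathcal{A}\mathbf{C}\rangle$, i.e. $V(\mathbf{P},\mathbf{T})=e^{\alpha\|\mathbf{P}\|^2/(2(1-\|\mathbf{P}\|^2))}(1-\|\mathbf{P}\|^2)^{-1/2}\langle\mathcal{A}\mathbf{P},\mathbf{T}\rangle$ for $\|\mathbf{P}\|<1$, extended by $V=0$ when $\|\mathbf{P}\|=1$. Let $0<\Omega_1<\dots<\Omega_{\bar m}$ be the distinct numbers such that $\pm\Omega_k$ are the nonzero eigenvalues of $i\mathcal{A}$, let $F_k=N(\mathcal{A}^2+\Omega_k^2\mathbf{1})$ be the corresponding real invariant subspace, with complex structure $\mathcal{J}_k=\Omega_k^{-1}\mathcal{A}|_{F_k}$; a complex line in $F_k$ is a real 2-plane spanned by $\mathbf{x},\mathcal{J}_k\mathbf{x}$, $0\neq\mathbf{x}\in F_k$. The trivial solitons are: (i) circles centered at the origin with radius $1/\sqrt{-\alpha}$ in a complex line in one of the $F_k$; (ii) Abresch-Langer curves in the null space $N(\mathcal{A})$, i.e. planar curves in $N(\mathcal{A})$ (compact or not) satisfying $\mathbf{C}_{ss}=\mathfrak{p}_{\mathbf{C}_s}(\alpha\mathbf{C})$,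 including straight lines through the origin in $N(\mathcal{A})$. *)

(* Defs.v *)
From mathcomp Require Import all_boot all_order all_algebra.
From mathcomp Require Import all_classical all_reals all_analysis.
From mathcomp.real_closed Require Import complex.

Set Implicit Arguments.
Unset Strict Implicit.
Unset Printing Implicit Defensive.

Import Order.TTheory GRing.Theory Num.Theory.
Import numFieldNormedType.Exports.

Local Open Scope classical_set_scope.
Local Open Scope ring_scope.

Section Euclidean.
Context {R : realType} {n : nat}.
Implicit Types u v w : 'cV[R]_n.

Definition dot u v : R := \sum_i u i 0 * v i 0.

(* The library norm on matrices is the sup norm; it induces the same topology,
   hence the same derivatives, but the geometry below is Euclidean. *)
Definition enorm u : R := Num.sqrt (dot u u).

Definition orth_proj u w : 'cV[R]_n := w - (dot w u / enorm u ^+ 2) *: u.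

End Euclidean.

Section CompactifiedFlow.
Context {R : realType} {n : nat}.
Variables (alpha : R) (A : 'M[R]_n).
Implicit Types P T : R -> 'cV[R]_n.

Definition is_flow_orbit P T : Prop :=
  forall t : R,
    [/\ enorm (P t) <= 1,
        enorm (T t) = 1,
        is_derive t 1 P
          ((1 - enorm (P t) ^+ 2) *: (T t - dot (P t) (T t) *: P t))
      & is_derive t 1 T (orth_proj (T t) ((alpha%:M + A) *m P t))].

Definition V_fun (p q : 'cV[R]_n) : R :=
  if enorm p < 1 then
    expR (alpha * enorm p ^+ 2 / (2 * (1 - enorm p ^+ 2)))
      * (Num.sqrt (1 - enorm p ^+ 2))^-1 * dot (A *m p) q
  else 0.

End CompactifiedFlow.

Section Solitons.
Context {R : realType} {n : nat}.
Implicit Types (alpha Omega : R) (A : 'M[R]_n) (C P T : R -> 'cV[R]_n).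

Definition is_soliton alpha A C : Prop :=
  forall s : R,
    [/\ derivable C s 1,
        enorm (derive1 C s) = 1
      & is_derive s 1 (derive1 C)
          (orth_proj (derive1 C s) ((alpha%:M + A) *m C s))].

(* [tau] is the change of parameter from the arc length s to the time of the
   compactified flow; its derivative is at least 1, so it is automatically an
   increasing bijection of R and the whole orbit is described. *)
Definition corresponds P T C : Prop :=
  exists tau : R -> R, forall s : R,
    [/\ is_derive s 1 tau (Num.sqrt (1 + enorm (C s) ^+ 2)),
        P (tau s) = (Num.sqrt (1 + enorm (C s) ^+ 2))^-1 *: C s
      & T (tau s) = derive1 C s].

(* The numbers Omega_k: iA is Hermitian with spectrum symmetric about 0, so
   they are its positive eigenvalues. *)
Definition is_frequency A Omega : Prop :=
  0 < Omega /\
  eigenvalue ('i%C *: map_mx (real_complex R) A) (real_complex R Omega).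

Definition freq_space A Omega : set 'cV[R]_n :=
  [set x | (A *m A + (Omega ^+ 2)%:M) *m x = 0].

Definition complex_line A Omega (x : 'cV[R]_n) : set 'cV[R]_n :=
  [set v | exists a b : R, v = a *: x + b *: (Omega^-1 *: (A *m x))].

Definition is_trivial_circle alpha A C : Prop :=
  is_soliton alpha A C /\
  exists (Omega : R) (x : 'cV[R]_n),
    [/\ is_frequency A Omega, freq_space A Omega x, x != 0
      & range C = [set v | complex_line A Omega x v /\
                           enorm v = (Num.sqrt (- alpha))^-1]].

(* Contained in a two-dimensional linear subspace; straight lines through the
   origin are included. *)
Definition is_planar C : Prop :=
  exists W : 'M[R]_(n, 2),
    \rank W = 2%N /\ forall s, exists c : 'cV[R]_2, C s = W *m c.

Definition is_abresch_langer alpha A C : Prop :=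
  [/\ is_soliton alpha 0 C, forall s, A *m C s = 0 & is_planar C].

Definition is_trivial_soliton alpha A C : Prop :=
  is_trivial_circle alpha A C \/ is_abresch_langer alpha A C.

End Solitons.

(* Main.v *)
Require Import Defs.
From mathcomp Require Import all_boot all_order all_algebra.
From mathcomp Require Import all_classical all_reals all_analysis.
From mathcomp Require Import ring lra.
From mathcomp.real_closed Require Import complex.
Set Implicit Arguments.
Unset Strict Implicit.
Unset Printing Implicit Defensive.

Import Order.TTheory GRing.Theory Num.Theory.
Import numFieldNormedType.Exports.
Local Open Scope ring_scope.

(** In terms of [rho = 1 - |P|^2], [a = <P, T>] and [l = <A P, T>], the flow gives
    [rho' = - 2 rho^2 a], so [rho] vanishes identically or never.  In the first
    case the orbit is at infinity and [V = 0].  In the second case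
      [V' = e^(alpha (1 - rho) / (2 rho)) rho^(-1/2) (|A P|^2 - l^2) >= 0]
    by the Cauchy-Schwarz inequality (lemma [derive_V]), so [V] is nondecreasing,
    and if it is not strictly increasing then it is constant on some interval,
    where [A P = l T].

    The rest is a unique continuation argument (lemma [V_stationary]).  If [V] is
    zero on the interval, then so are [l], [A P] and, by differentiation, [A T].
    If [V] is not zero there, then [a = <P, A P> / l = 0], so [rho] is constant,
    [a' = 0] gives [rho + alpha (1 - rho) = 0], then [l] is constant, and
    differentiating [A P = l T] makes [A T] a multiple of [P].  Each of these sets
    of relations is governed by a linear homogeneous system with bounded
    coefficients along the orbit, so by Gronwall's lemma it holds for all times as
    soon as it holds once ([linear_invariant], [circle_radius], [circle_plane]).
    In both cases [V] is constant along the whole orbit.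

    To get back to a curve [C = rho^(-1/2) P] one inverts the change of parameter
    [ds = rho^(1/2) dt].  Here [w = rho^(-1/2)] satisfies [|w'| <= 1 / w], which
    is enough for the arc length to cover the whole line ([time_change]).  In the
    first case [A C = 0], and [C] stays in a plane containing its initial position
    and velocity, by [linear_invariant] applied to a matrix whose kernel is this
    plane.  In the second case [C'' = alpha C], so [C] is an explicit circle, and
    [A] acts on its plane as a multiple of the quarter turn. *)

(** * The Euclidean inner product *)

Lemma normM_le (R : realType) (x y c d : R) : `|x| <= c -> `|y| <= d -> `|x * y| <= c * d.
Proof. by move=> h1 h2; rewrite normrM ler_pM. Qed.

Section Dot.
Context {R : realType} {n : nat}.
Implicit Types (u v w : 'cV[R]_n) (A : 'M[R]_n).

Lemma dotC u v : dot u v = dot v u.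
Proof. by apply: eq_bigr => i _; rewrite mulrC. Qed.

Lemma dotDl u v w : dot (u + v) w = dot u w + dot v w.
Proof. by rewrite -big_split; apply: eq_bigr => i _; rewrite mxE mulrDl. Qed.

Lemma dotZl k u v : dot (k *: u) v = k * dot u v.
Proof. by rewrite big_distrr; apply: eq_bigr => i _; rewrite mxE -mulrA. Qed.

Lemma dotNl u v : dot (- u) v = - dot u v.
Proof. by rewrite -scaleN1r dotZl mulN1r. Qed.

Lemma dotDr u v w : dot w (u + v) = dot w u + dot w v.
Proof. by rewrite dotC dotDl !(dotC w). Qed.

Lemma dotZr k u v : dot v (k *: u) = k * dot v u.
Proof. by rewrite dotC dotZl (dotC v). Qed.

Lemma dotNr u v : dot v (- u) = - dot v u.
Proof. by rewrite dotC dotNl (dotC v). Qed.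

Lemma dot0l v : dot 0 v = 0.
Proof. by rewrite -(scale0r 0) dotZl mul0r. Qed.

Definition dot_linE := (dotDl, dotDr, dotNl, dotNr, dotZl, dotZr).

Lemma dot_ge0 u : 0 <= dot u u.
Proof. by apply: sumr_ge0 => i _; rewrite -expr2 sqr_ge0. Qed.

Lemma dot_eq0 u : dot u u = 0 -> u = 0.
Proof.
move=> /eqP; rewrite psumr_eq0 => [/allP h|i _]; last by rewrite -expr2 sqr_ge0.
apply/matrixP => i j; rewrite ord1 mxE.
by have := h i (mem_index_enum _); rewrite mulf_eq0 orbb => /eqP.
Qed.

Lemma enorm_sqr u : enorm u ^+ 2 = dot u u.
Proof. by rewrite sqr_sqrtr ?dot_ge0. Qed.

Lemma dot_mulmx_anti A u v : A^T = - A -> dot (A *m u) v = - dot u (A *m v).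
Proof.
have dotE x y : dot x y = (x^T *m y) 0 0.
  by rewrite mxE; apply: eq_bigr => i _; rewrite !mxE.
by move=> hA; rewrite !dotE trmx_mul hA mulmxN mulNmx mxE mulmxA.
Qed.

Lemma dot_mulmx_anti0 A u : A^T = - A -> dot (A *m u) u = 0.
Proof. by move=> hA; have := dot_mulmx_anti u u hA; rewrite (dotC u); lra. Qed.

(** The Cauchy-Schwarz deficit against a unit vector is a squared distance. *)
Lemma dot_sub_proj u v : dot v v = 1 ->
  dot (u - dot u v *: v) (u - dot u v *: v) = dot u u - dot u v ^+ 2.
Proof. by move=> hv; rewrite !dot_linE hv (dotC v u); ring. Qed.

Lemma dot_sqr_le u v : dot v v = 1 -> dot u v ^+ 2 <= dot u u.
Proof. by move=> hv; rewrite -subr_ge0 -dot_sub_proj // dot_ge0. Qed.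

Lemma dot_norm_le u v : `|dot u v| * 2 <= dot u u + dot v v.
Proof.
have := dot_ge0 (u + v); have := dot_ge0 (u - v).
rewrite !dot_linE (dotC v u); case: (ger0P (dot u v)); lra.
Qed.

(** The constant is the sum of the squared l1 norms of the rows. *)
Lemma dot_mulmx_bounded A :
  exists2 K, 0 <= K & forall u, dot (A *m u) (A *m u) <= K * dot u u.
Proof.
have hu u i : `|u i 0| ^+ 2 <= dot u u.
  rewrite real_normK ?num_real // /dot (bigD1 i) //= expr2 lerDl.
  by apply: sumr_ge0 => j _; rewrite -expr2 sqr_ge0.
exists (\sum_(i < n) (\sum_(j < n) `|A i j|) ^+ 2).
  by apply: sumr_ge0 => i _; rewrite sqr_ge0.
move=> u; rewrite mulr_suml; apply: ler_sum => i _.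
rewrite -expr2 -(sqr_sqrtr (dot_ge0 u)) -exprMn -real_normK ?num_real //.
rewrite lerXn2r ?nnegrE ?mulr_ge0 ?sumr_ge0 ?sqrtr_ge0 //.
rewrite mxE mulr_suml; apply: le_trans (ler_norm_sum _ _ _) _.
apply: ler_sum => j _; rewrite normrM ler_wpM2l // -[`|u j 0|]ger0_norm //.
by rewrite -sqrtr_sqr ler_sqrt ?dot_ge0.
Qed.

End Dot.

(** * Derivatives of curves *)

Section Derivatives.
Context {R : realType}.
Implicit Types (f g k : R -> R) (t : R).

Lemma derD t f g df dg : is_derive t 1 f df -> is_derive t 1 g dg ->
  is_derive t 1 (fun s => f s + g s) (df + dg).
Proof. exact: is_deriveD. Qed.

Lemma derM t f g df dg : is_derive t 1 f df -> is_derive t 1 g dg ->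
  is_derive t 1 (fun s => f s * g s) (df * g t + f t * dg).
Proof.
by move=> hf hg; apply: trigger_derive (is_deriveM hf hg) _; rewrite /GRing.scale /=; ring.
Qed.

Lemma eq_is_derive (W : normedModType R) t (F G : R -> W) dF dG : F =1 G ->
  dF = dG -> is_derive t 1 F dF -> is_derive t 1 G dG.
Proof. by move=> /funext -> ->. Qed.

Lemma is_derive_colP n (f : R -> 'cV[R]_n) df t :
  is_derive t 1 f df <-> forall i, is_derive t 1 (fun s => f s i 0) (df i 0).
Proof.
split=> [[hf <-] i|h].
  have hi := (derivable_mxP _ _ _).1 hf i 0.
  by rewrite derive_mx // mxE; exact: derivableP.
have hf : derivable f t 1.
  by apply/derivable_mxP => i j; rewrite ord1; case: (h i).
split=> //; rewrite derive_mx //; apply/matrixP => i j.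
by rewrite ord1 mxE; case: (h i).
Qed.

Context {n : nat}.
Implicit Types (F G : R -> 'cV[R]_n).

Lemma is_derive_dot t F G dF dG : is_derive t 1 F dF -> is_derive t 1 G dG ->
  is_derive t 1 (fun s => dot (F s) (G s)) (dot dF (G t) + dot (F t) dG).
Proof.
move=> /is_derive_colP hF /is_derive_colP hG.
have h i := derM (hF i) (hG i).
have := is_derive_sum h.
by rewrite big_split fct_sumE.
Qed.

Lemma is_derive_mulmx m (B : 'M[R]_(m, n)) t F dF : is_derive t 1 F dF ->
  is_derive t 1 (fun s => B *m F s) (B *m dF).
Proof.
move=> /is_derive_colP hF; apply/is_derive_colP => i.
have h j : is_derive t 1 (fun s => B i j * F s j 0) (B i j * dF j 0).
  by have := is_deriveZ (B i j) (hF j).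
have := is_derive_sum h.
apply: eq_is_derive => [s|]; last by rewrite mxE.
by rewrite fct_sumE mxE.
Qed.

Lemma is_derive_scale t k dk F dF : is_derive t 1 k dk -> is_derive t 1 F dF ->
  is_derive t 1 (fun s => k s *: F s) (dk *: F t + k t *: dF).
Proof.
move=> hk /is_derive_colP hF; apply/is_derive_colP => i.
by apply: eq_is_derive (derM hk (hF i)) => [s|]; rewrite !mxE.
Qed.

Lemma is_derive_comp_col t (tau : R -> R) dtau F dF :
  is_derive t 1 tau dtau -> is_derive (tau t) 1 F dF ->
  is_derive t 1 (fun s => F (tau s)) (dtau *: dF).
Proof.
move=> ht /is_derive_colP hF; apply/is_derive_colP => i.
by have := is_derive1_comp (hF i) ht; rewrite mxE mulrC.
Qed.

Lemma is_derive_continuous (f df : R -> R) :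
  (forall t : R, is_derive t 1 f (df t)) -> continuous f.
Proof.
by move=> h t; apply/differentiable_continuous/derivable1_diffP; case: (h t).
Qed.

End Derivatives.

(** * Monotonicity and Gronwall's lemma *)

Section Monotone.
Context {R : realType}.

Lemma der_ge0_homo (f df : R -> R) : (forall t : R, is_derive t 1 f (df t)) ->
  (forall t, 0 <= df t) -> {homo f : x y / x <= y}.
Proof.
move=> hf hd x y xy; rewrite -subr_ge0.
have [|c _ ->] := @MVT_segment R f df x y xy (fun z _ => hf z).
  exact/continuous_subspaceT/(is_derive_continuous hf).
by rewrite mulr_ge0 // subr_ge0.
Qed.

(** Gronwall: a nonnegative function whose growth rate, forwards and backwards
    in time, is at most proportional to itself is zero as soon as it vanishes
    once. *)
Lemma gronwall_eq0 (f df : R -> R) (K t0 : R) :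
  (forall t : R, is_derive t 1 f (df t)) -> (forall t, 0 <= f t) ->
  (forall t, `|df t| <= K * f t) -> f t0 = 0 -> forall t, f t = 0.
Proof.
move=> hf f0 hK ft0 t.
(* Backwards in time [f e^(K s)] is nondecreasing; forwards, [f e^(- K s)] is
   nonincreasing. *)
have hE (c s : R) : is_derive s 1 (fun s => f s * expR (c * s))
    ((df s + c * f s) * expR (c * s)).
  have h1 : is_derive s 1 (fun s => c * s) c.
    by apply: trigger_derive (is_deriveZ c (is_derive_id s 1)) _; exact: mulr1.
  have h2 := is_derive1_comp (is_derive_expR (c * s)) h1.
  by apply: trigger_derive (derM (hf s) h2) _; rewrite /=; ring.
have hb s : (- (K * f s) <= df s) && (df s <= K * f s) by rewrite -ler_norml.
have key c : f t * expR (c * t) <= 0 -> f t = 0.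
  by rewrite pmulr_lle0 ?expR_gt0 // => h; apply/eqP; rewrite eq_le h f0.
case: (leP t t0) => [tt0|/ltW t0t].
  apply: (key K); rewrite -(mul0r (expR (K * t0))) -ft0.
  apply: (der_ge0_homo (hE K)) tt0 => s.
  by rewrite mulr_ge0 ?expR_ge0 //; move/andP: (hb s) => [] *; lra.
apply: (key (- K)); rewrite -(mul0r (expR (- K * t0))) -ft0 -lerN2.
have hN (s : R) : is_derive s 1 (fun s => - (f s * expR (- K * s)))
    (- ((df s + - K * f s) * expR (- K * s))).
  exact: is_deriveN (hE (- K) s).
apply: (der_ge0_homo hN) t0t => s.
rewrite oppr_ge0 pmulr_lle0 ?expR_gt0 //; move/andP: (hb s) => [] *; lra.
Qed.

(** Gronwall for a pair of curves, with the sum of the squared norms as energy. *)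
Lemma gronwall_pair (n : nat) (Y Z dY dZ : R -> 'cV[R]_n) (K t0 : R) :
  (forall t : R, is_derive t 1 Y (dY t)) -> (forall t : R, is_derive t 1 Z (dZ t)) ->
  (forall t, `|dot (Y t) (dY t) + dot (Z t) (dZ t)|
             <= K * (dot (Y t) (Y t) + dot (Z t) (Z t))) ->
  Y t0 = 0 -> Z t0 = 0 -> forall t, Y t = 0 /\ Z t = 0.
Proof.
move=> hY hZ hK Y0 Z0 t.
have hd (s : R) : is_derive s 1 (fun s => dot (Y s) (Y s) + dot (Z s) (Z s))
    (2 * (dot (Y s) (dY s) + dot (Z s) (dZ s))).
  apply: eq_is_derive (derD (is_derive_dot (hY s) (hY s))
    (is_derive_dot (hZ s) (hZ s))) => //.
  by rewrite (dotC (dY s)) (dotC (dZ s)); ring.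
have f0 s : 0 <= dot (Y s) (Y s) + dot (Z s) (Z s) by rewrite addr_ge0 ?dot_ge0.
have fK s : `|2 * (dot (Y s) (dY s) + dot (Z s) (dZ s))|
    <= 2 * K * (dot (Y s) (Y s) + dot (Z s) (Z s)).
  by rewrite normrM (ger0_norm (ler0n _ 2)) -mulrA ler_pM2l.
have := @gronwall_eq0 _ _ _ t0 hd f0 fK _ t.
rewrite Y0 Z0 dot0l addr0 => /(_ erefl) h.
have := dot_ge0 (Y t); have := dot_ge0 (Z t) => h1 h2.
by split; apply: dot_eq0; lra.
Qed.

End Monotone.

(** * Invariants of the compactified flow *)

Section Flow.
Context {R : realType} {n : nat} (alpha : R) (A : 'M[R]_n) (P T : R -> 'cV[R]_n).
Context (hA : A^T = - A) (hX : is_flow_orbit alpha A P T).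

(* For [C = rho^(-1/2) P], [rho = (1 + |C|^2)^-1]. *)
Local Notation rho t := (1 - dot (P t) (P t)).
Local Notation a t := (dot (P t) (T t)).
Local Notation l t := (dot (A *m P t) (T t)).

Lemma orbit_T1 t : dot (T t) (T t) = 1.
Proof. by case: (hX t) => _ h _ _; rewrite -enorm_sqr h expr1n. Qed.

Lemma orbit_rho_ge0 t : 0 <= rho t.
Proof.
case: (hX t) => h _ _ _.
by rewrite -enorm_sqr subr_ge0 expr_le1 // sqrtr_ge0.
Qed.

Lemma orbit_rho_le1 t : rho t <= 1.
Proof. by rewrite gerBl dot_ge0. Qed.

Lemma orbit_rho_norm t : `|rho t| <= 1.
Proof. by rewrite ger0_norm ?orbit_rho_ge0 ?orbit_rho_le1. Qed.

Lemma orbit_a_norm t : `|a t| <= 1.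
Proof.
rewrite -(@expr_le1 _ 2) // real_normK ?num_real //.
by apply: le_trans (dot_sqr_le _ (orbit_T1 t)) _; rewrite -subr_ge0 orbit_rho_ge0.
Qed.

Lemma orbit_l_bounded : exists2 L, 0 <= L & forall t, `|l t| <= L.
Proof.
have [K K0 hK] := dot_mulmx_bounded A; exists (K + 1); first by lra.
move=> t; have := dot_norm_le (A *m P t) (T t).
rewrite orbit_T1; have := hK (P t); have := orbit_rho_ge0 t => h1 h2.
have : K * dot (P t) (P t) <= K by rewrite ler_piMr // -subr_ge0.
by have := normr_ge0 (l t); lra.
Qed.

Lemma derive_P (t : R) : is_derive t 1 P (rho t *: (T t - a t *: P t)).
Proof. by case: (hX t) => _ _; rewrite enorm_sqr. Qed.

Lemma derive_T (t : R) :
  is_derive t 1 T (alpha *: P t + A *m P t - (alpha * a t + l t) *: T t).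
Proof.
case: (hX t) => _ h1 _; rewrite /orth_proj h1 expr1n divr1.
by rewrite mulmxDl mul_scalar_mx dotDl dotZl.
Qed.

Lemma derive_rho (t : R) : is_derive t 1 (fun s => rho s) (- (2 * rho t ^+ 2 * a t)).
Proof.
have h := is_deriveN (is_derive_dot (derive_P t) (derive_P t)).
apply: eq_is_derive (derD (is_derive_cst (1 : R) t 1) h) => //.
by rewrite !dot_linE (dotC (T t)); ring.
Qed.

Lemma derive_a (t : R) : is_derive t 1 (fun s => a s)
  (rho t + alpha * (1 - rho t) - ((rho t + alpha) * a t + l t) * a t).
Proof.
apply: eq_is_derive (is_derive_dot (derive_P t) (derive_T t)) => //.
by rewrite !dot_linE orbit_T1 (dotC (P t) (A *m _)) dot_mulmx_anti0 //; ring.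
Qed.

Lemma derive_l (t : R) : is_derive t 1 (fun s => l s)
  (dot (A *m P t) (A *m P t) - l t ^+ 2 - (rho t + alpha) * a t * l t).
Proof.
apply: eq_is_derive (is_derive_dot (is_derive_mulmx A (derive_P t)) (derive_T t)) => //.
by rewrite -!scalemxAr mulmxBr -!scalemxAr !dot_linE !dot_mulmx_anti0 //; ring.
Qed.

(** Uniqueness at infinity: the sphere is invariant. *)
Lemma rho_eq0 t0 : rho t0 = 0 -> forall t, rho t = 0.
Proof.
move=> h0 t.
have hd (s : R) : is_derive s 1 (fun s => rho s * rho s)
    (- (2 * rho s ^+ 2 * a s) * rho s + rho s * - (2 * rho s ^+ 2 * a s)).
  by apply: derM; exact: derive_rho.
have := @gronwall_eq0 _ _ _ 4 t0 hd _ _ _ t; rewrite h0 mul0r => h.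
apply/eqP; rewrite -sqrf_eq0 expr2; apply/eqP; apply: h => // s.
  by rewrite -expr2 sqr_ge0.
rewrite (_ : _ + _ = - 4 * (rho s * a s) * (rho s * rho s)); last by ring.
rewrite -!expr2 normrM (ger0_norm (sqr_ge0 _)) ler_wpM2r ?sqr_ge0 //.
rewrite normrM normrN (ger0_norm (ler0n _ 4)) ler_piMr //.
by have := normM_le (orbit_rho_norm s) (orbit_a_norm s); rewrite mulr1.
Qed.

(** A linear condition [B P = 0], satisfied once together with [B T = 0], is
    preserved by the flow when [B A P] is controlled by [B P]: then [B P] and
    [B T] obey a linear homogeneous system with bounded coefficients. *)
Lemma linear_invariant (B : 'M[R]_n) (K t0 : R) : 0 <= K ->
  (forall t, dot (B *m (A *m P t)) (B *m (A *m P t))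
             <= K * dot (B *m P t) (B *m P t)) ->
  B *m P t0 = 0 -> B *m T t0 = 0 -> forall t, B *m P t = 0 /\ B *m T t = 0.
Proof.
move=> K0 hK; have [L L0 hL] := orbit_l_bounded.
pose dY t := rho t *: (B *m T t - a t *: (B *m P t)).
pose dZ t := alpha *: (B *m P t) + B *m (A *m P t) - (alpha * a t + l t) *: (B *m T t).
apply: (@gronwall_pair _ _ _ _ dY dZ (2 * `|alpha| + L + K + 3)) => s.
- apply: eq_is_derive (is_derive_mulmx B (derive_P s)) => //.
  by rewrite -scalemxAr mulmxBr -scalemxAr.
- apply: eq_is_derive (is_derive_mulmx B (derive_T s)) => //.
  by rewrite mulmxBr mulmxDr -!scalemxAr.
rewrite /dY /dZ !dot_linE.
set Y := B *m P s; set Z := B *m T s; set w := B *m _.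
rewrite (dotC Z Y).
have hw := hK s; rewrite -/w -/Y in hw.
have := dot_norm_le Y Z; have := dot_norm_le Z w.
have := dot_ge0 Y; have := dot_ge0 Z.
have hr := orbit_rho_norm s; have ha := orbit_a_norm s; have hl := hL s.
set yy := dot Y Y in hw *; set zz := dot Z Z; set yz := dot Y Z; set zw := dot Z w.
move=> zz0 yy0 hzw hyz.
have hyz' : `|yz| <= yy + zz by have := normr_ge0 yz; lra.
have hzw' : `|zw| <= K * yy + zz.
  by have := normr_ge0 zw; have := mulr_ge0 K0 yy0; lra.
have b1 := normM_le hr hyz'.
have hra := normM_le hr ha.
have b2 : `|rho s * a s * yy| <= 1 * 1 * yy by apply: normM_le; rewrite // ger0_norm.
have b3 := normM_le (lexx `|alpha|) hyz'.
have b4 : `|alpha * a s * zz| <= `|alpha| * 1 * zz.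
  by apply: normM_le; [exact: normM_le|rewrite ger0_norm].
have b5 : `|l s * zz| <= L * zz by apply: normM_le; rewrite // ger0_norm.
have K1 := mulr_ge0 K0 zz0; have L1 := mulr_ge0 L0 yy0.
have A1 := mulr_ge0 (normr_ge0 alpha) yy0.
rewrite ler_norml.
move: hzw' b1 b2 b3 b4 b5; rewrite !ler_norml.
move=> /andP[? ?] /andP[? ?] /andP[? ?] /andP[? ?] /andP[? ?] /andP[? ?].
apply/andP; split; lra.
Qed.

(** The conditions [a = 0] and [r = 0], where [r = rho + alpha (1 - rho)], say that
    [|C|] is stationary with value [(- alpha)^(-1/2)].  They persist because
    [r' = - 2 (1 - alpha) rho^2 a] and [a' = r - ((rho + alpha) a + l) a]. *)
Lemma circle_radius t0 : a t0 = 0 -> rho t0 + alpha * (1 - rho t0) = 0 ->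
  forall t, a t = 0 /\ rho t + alpha * (1 - rho t) = 0.
Proof.
move=> a0 r0 t; have [L L0 hL] := orbit_l_bounded.
pose r s := rho s + alpha * (1 - rho s).
have hr (s : R) : is_derive s 1 r (- ((1 - alpha) * (2 * rho s ^+ 2 * a s))).
  apply: eq_is_derive (derD (is_derive_cst alpha s 1)
    (is_deriveZ (1 - alpha) (derive_rho s))) => [u|].
    by rewrite /r /= /GRing.scale /=; ring.
  by rewrite /GRing.scale /=; ring.
have hd (s : R) := derD (derM (derive_a s) (derive_a s)) (derM (hr s) (hr s)).
have := @gronwall_eq0 _ _ _ (2 * (1 + `|alpha| + L) + 8 * (1 + `|alpha|) + 4)
  t0 hd _ _ _ t.
have -> : r t0 = 0 by [].
rewrite a0 !mul0r addr0 -!expr2 => h.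
have {}h : a t ^+ 2 + r t ^+ 2 = 0.
  apply: h => // s; first by rewrite -!expr2 addr_ge0 ?sqr_ge0.
  have ha := orbit_a_norm s; have hl := hL s; have hrh := orbit_rho_norm s.
  rewrite -/(r s); move: (r s) => rs.
  set X := (X in `|X|).
  set c := (rho s + alpha) * a s + l s.
  have -> : X = 2 * (a s * rs) - 2 * c * (a s ^+ 2)
                - 4 * (1 - alpha) * (rho s ^+ 2) * (a s * rs).
    by rewrite /X /c; ring.
  have hc : `|c| <= 1 + `|alpha| + L.
    apply: le_trans (ler_normD _ _) _; apply: lerD => //.
    rewrite -[leRHS]mulr1; apply: normM_le => //.
    by apply: le_trans (ler_normD _ _) _; rewrite lerD.
  have h1 : `|1 - alpha| <= 1 + `|alpha|.
    by apply: le_trans (ler_normB _ _) _; rewrite normr1.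
  have h2 : `|rho s ^+ 2| <= 1 by rewrite normrX expr_le1.
  have h3 : `|a s * rs| <= a s * a s + rs * rs.
    rewrite ler_norml; apply/andP; split; nra.
  have b1 : `|c * a s ^+ 2| <= (1 + `|alpha| + L) * (a s * a s).
    by apply: normM_le; rewrite // ger0_norm ?sqr_ge0 // expr2.
  have b2 : `|(1 - alpha) * rho s ^+ 2 * (a s * rs)|
      <= (1 + `|alpha|) * 1 * (a s * a s + rs * rs).
    by apply: normM_le => //; exact: normM_le.
  have := normr_ge0 alpha => al0.
  have p1 : 0 <= (1 + `|alpha| + L) * (rs * rs).
    by rewrite mulr_ge0 ?addr_ge0 // -expr2 sqr_ge0.
  have q1 : 0 <= a s * a s by rewrite -expr2 sqr_ge0.
  have q2 : 0 <= rs * rs by rewrite -expr2 sqr_ge0.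
  have p2 : 0 <= (1 + `|alpha|) * (a s * a s) by rewrite mulr_ge0 ?addr_ge0.
  have p3 : 0 <= (1 + `|alpha|) * (rs * rs) by rewrite mulr_ge0 ?addr_ge0.
  move: h3 b1 b2; rewrite !ler_norml.
  move=> /andP[? ?] /andP[? ?] /andP[? ?].
  by apply/andP; split; lra.
move/eqP: h; rewrite paddr_eq0 ?sqr_ge0 // !sqrf_eq0 => /andP[/eqP ? /eqP ?].
by split.
Qed.

(** When [a = 0], [rho] is constant and [rho nu = mu alpha], the relations
    [A P = mu T] and [A T = nu P] persist: the defects [Y = A P - mu T] and
    [Z = A T - nu P] satisfy [Y' = rho Z - mu Y + mu <Y, T> T] and
    [Z' = alpha Y + A Y - <Y, T> A T]. *)
Lemma circle_plane (mu nu rho0 t0 : R) :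
  (forall t, a t = 0) -> (forall t, rho t = rho0) -> rho0 * nu = mu * alpha ->
  A *m P t0 = mu *: T t0 -> A *m T t0 = nu *: P t0 ->
  forall t, A *m P t = mu *: T t /\ A *m T t = nu *: P t.
Proof.
move=> ha hr hnu hP hT t; have [K K0 hK] := dot_mulmx_bounded A.
pose Y s := A *m P s - mu *: T s; pose Z s := A *m T s - nu *: P s.
pose dY s := rho0 *: Z s - mu *: Y s + (mu * dot (Y s) (T s)) *: T s.
pose dZ s := alpha *: Y s + A *m Y s - dot (Y s) (T s) *: (A *m T s).
have hl s : l s = dot (Y s) (T s) + mu.
  by rewrite /Y dotDl dotNl dotZl orbit_T1; ring.
suff [] : Y t = 0 /\ Z t = 0.
  by move=> /eqP; rewrite subr_eq0 => /eqP -> /eqP; rewrite subr_eq0 => /eqP ->.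
apply: (@gronwall_pair _ _ _ _ dY dZ
  (`|rho0| + 2 * `|mu| + `|alpha| + 2 * K + 4) t0) => [s|s|s||].
- have h := is_derive_scale (is_derive_cst (- mu) s 1) (derive_T s).
  apply: eq_is_derive (is_deriveD (is_derive_mulmx A (derive_P s)) h) => [u|].
    by rewrite /Y !fctE /= scaleNr.
  rewrite ha hr hl /dY -!scalemxAr mulmxBr -!scalemxAr /Z /Y.
  set d := dot _ _; apply/matrixP => i j; rewrite !mxE /cst.
  by have := congr1 (fun x => x * P s i j) hnu; lra.
- have h := is_derive_scale (is_derive_cst (- nu) s 1) (derive_P s).
  apply: eq_is_derive (is_deriveD (is_derive_mulmx A (derive_T s)) h) => [u|].
    by rewrite /Z !fctE /= scaleNr.
  rewrite ha hr hl /dZ {2 3}/Y !mulmxBr mulmxDr -!scalemxAr.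
  set d := dot _ _; set u := A *m (A *m P s); set v := A *m P s; set w := A *m T s.
  apply/matrixP => i j; rewrite !mxE /cst.
  by have := congr1 (fun x => x * T s i j) hnu; lra.
- rewrite /dY /dZ.
  move: (Y s) (Z s) (T s) (orbit_T1 s) => y z q hq.
  have hv : dot (dot y q *: (A *m q)) (dot y q *: (A *m q)) <= K * dot y y.
    rewrite dotZl dotZr mulrA -expr2 mulrC ler_pM ?dot_ge0 ?sqr_ge0 //.
      by have := hK q; rewrite hq mulr1.
    exact: dot_sqr_le.
  have hAy := hK y.
  have := dot_norm_le z (dot y q *: (A *m q)).
  have := dot_norm_le z (A *m y); have := dot_norm_le y z.
  rewrite !(dotDr, dotNr).
  move: (dot y q *: (A *m q)) hv => w hv.
  rewrite !dotZr (dotC z y).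
  have := dot_sqr_le y hq; have := dot_ge0 y; have := dot_ge0 z.
  have := sqr_ge0 (dot y q).
  set yy := dot y y in hv hAy *; set zz := dot z z; set yz := dot y z; set yq := dot y q.
  move=> yq0 zz0 yy0 hyq hyz hzA hzw.
  have hyz' : `|yz| <= yy + zz by have := normr_ge0 yz; lra.
  have c1 := normM_le (lexx `|rho0|) hyz'.
  have c2 : `|mu * yy| <= `|mu| * yy by apply: normM_le; rewrite // ger0_norm.
  have c3 : `|mu * yq ^+ 2| <= `|mu| * yy by apply: normM_le; rewrite // ger0_norm.
  have c4 := normM_le (lexx `|alpha|) hyz'.
  have := normr_ge0 (dot z (A *m y)); have := normr_ge0 (dot z w).
  have := mulr_ge0 K0 yy0; have := mulr_ge0 K0 zz0.
  have := mulr_ge0 (normr_ge0 mu) zz0; have := mulr_ge0 (normr_ge0 rho0) yy0.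
  move=> ? ? ? ? ? ?.
  have e1 : `|dot z (A *m y)| <= K * yy + zz by lra.
  have e2 : `|dot z w| <= K * yy + zz by lra.
  move: c1 c2 c3 c4 e1 e2; rewrite !ler_norml.
  move=> /andP[? ?] /andP[? ?] /andP[? ?] /andP[? ?] /andP[? ?] /andP[? ?].
  by apply/andP; split; lra.
- by rewrite /Y hP subrr.
- by rewrite /Z hT subrr.
Qed.

End Flow.

(** * Monotonicity of V *)

Lemma derive_locally_cst (R : realType) (W : normedModType R) (F : R -> W)
    (c dF : W) (t1 t2 t : R) :
  t \in `]t1, t2[ -> (forall s, s \in `]t1, t2[ -> F s = c) ->
  is_derive t 1 F dF -> dF = 0.
Proof.
move=> ht hF [_ <-]; rewrite -(derive_cst c t 1); apply: near_eq_derive.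
by apply: filterS (near_in_itvoo ht) => s; exact: hF.
Qed.

Section Lyapunov.
Context {R : realType} {n : nat} (alpha : R) (A : 'M[R]_n) (P T : R -> 'cV[R]_n).
Context (alpha_lt0 : alpha < 0) (hA : A^T = - A) (hX : is_flow_orbit alpha A P T).

Local Notation rho t := (1 - dot (P t) (P t)).
Local Notation a t := (dot (P t) (T t)).
Local Notation l t := (dot (A *m P t) (T t)).
Local Notation V t := (V_fun alpha A (P t) (T t)).

(** The weight of [V] as a function of [1 - |P|^2]. *)
Definition weight (r : R) : R :=
  expR (alpha * (1 - r) / (2 * r)) * (Num.sqrt r)^-1.

Lemma weight_gt0 r : 0 < r -> 0 < weight r.
Proof. by move=> r0; rewrite mulr_gt0 ?expR_gt0 // invr_gt0 sqrtr_gt0. Qed.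

Lemma derive_weight (r : R) : 0 < r ->
  is_derive r 1 weight (- (weight r * (alpha / (2 * r ^+ 2) + (2 * r)^-1))).
Proof.
move=> r0; have rN0 : r != 0 by rewrite gt_eqF.
have sN0 : Num.sqrt r != 0 by rewrite gt_eqF // sqrtr_gt0.
have h1 : is_derive r 1 (fun r => alpha * (1 - r) / (2 * r)) (- (alpha / (2 * r ^+ 2))).
  have hn : is_derive r 1 (fun r => alpha * (1 - r)) (- alpha).
    apply: eq_is_derive (is_deriveZ alpha (is_deriveB (is_derive_cst (1 : R) r 1)
      (is_derive_id r 1))) => //.
    by rewrite /GRing.scale /=; ring.
  have hd : is_derive r 1 (fun r => 2 * r) 2.
    apply: eq_is_derive (is_deriveZ (2 : R) (is_derive_id r 1)) => //.
    by rewrite /GRing.scale /=; ring.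
  have d0 : 2 * r != 0 by rewrite mulf_neq0.
  apply: eq_is_derive (derM hn (is_deriveV d0 hd)) => //.
  by rewrite /GRing.scale /=; field.
have h2 := is_derive1_comp (is_derive_expR _) h1.
have h3 := is_deriveV sN0 (is_derive1_sqrt r0).
apply: eq_is_derive (derM h2 h3) => //.
rewrite /weight /GRing.scale /= (_ : (2 * r)^-1 = (Num.sqrt r ^+ 2 * 2)^-1); last first.
  by rewrite sqr_sqrtr ?(ltW r0) // mulrC.
by field; rewrite sN0 rN0.
Qed.

Lemma V_inside t : 0 < rho t -> V t = weight (rho t) * l t.
Proof.
move=> h; rewrite /V_fun ifT; last first.
  by rewrite -(@expr_lt1 _ 2) ?sqrtr_ge0 // enorm_sqr -subr_gt0.
by rewrite enorm_sqr /weight opprB addrCA subrr addr0.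
Qed.

Context (rho_gt0 : forall t, 0 < rho t).

Lemma derive_V (t : R) : is_derive t 1 (fun s => V s)
  (weight (rho t) * (dot (A *m P t) (A *m P t) - l t ^+ 2)).
Proof.
have h := @is_derive1_comp R weight (fun s => rho s) t _ _
  (derive_weight (rho_gt0 t)) (derive_rho hX t).
apply: eq_is_derive (derM h (derive_l hA hX t)) => [s|].
  by rewrite V_inside.
have rN0 : rho t != 0 by rewrite gt_eqF.
by rewrite /=; field.
Qed.

Lemma V_homo : {homo (fun t => V t) : x y / x <= y}.
Proof.
apply: (der_ge0_homo derive_V) => t.
by rewrite mulr_ge0 ?(ltW (weight_gt0 _)) // subr_ge0 dot_sqr_le ?(orbit_T1 hX).
Qed.

(** The position and the velocity both lie in the null space of [A]. *)
Definition kernel_orbit := forall t, A *m P t = 0 /\ A *m T t = 0.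

(** Motion on a circle centered at the origin, in a plane invariant under [A] on
    which [A] exchanges the directions of [P] and [T]; the relations between the
    constants are those imposed by the flow. *)
Definition circle_orbit (mu nu rho0 : R) :=
  [/\ mu != 0, rho0 * nu = mu * alpha, rho0 + alpha * (1 - rho0) = 0 &
      forall t, [/\ a t = 0, rho t = rho0, A *m P t = mu *: T t
                  & A *m T t = nu *: P t]].

(** Constancy of [V] between two times determines the whole orbit. *)
Lemma V_stationary (t1 t2 : R) : t1 < t2 -> V t1 = V t2 ->
  kernel_orbit \/ exists mu nu rho0, circle_orbit mu nu rho0.
Proof.
move=> t12 hV.
(* [V] is nondecreasing, hence constant between [t1] and [t2], and the vanishing
   of [V'] is the equality case of the Cauchy-Schwarz inequality. *)
have hVc s : s \in `]t1, t2[ -> V s = V t1.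
  rewrite in_itv => /andP[h1 h2]; apply/eqP; rewrite eq_le.
  by rewrite {1}hV !V_homo // ltW.
have hAP s : s \in `]t1, t2[ -> A *m P s = l s *: T s.
  move=> hs; have := derive_locally_cst hs hVc (derive_V s).
  move=> /eqP; rewrite mulf_eq0 gt_eqF ?weight_gt0 //= => /eqP h.
  apply/eqP; rewrite -subr_eq0; apply/eqP; apply: dot_eq0.
  by rewrite dot_sub_proj ?(orbit_T1 hX).
pose t0 := (t1 + t2) / 2.
have ht0 : t0 \in `]t1, t2[ by rewrite in_itv /= /t0; apply/andP; split; lra.
have rN0 s : rho s != 0 by rewrite gt_eqF.
have [V0|VN0] := eqVneq (V t1) 0.
  left; have hAP0 s : s \in `]t1, t2[ -> A *m P s = 0.
    move=> hs; have := hVc s hs; rewrite V0 V_inside // => /eqP.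
    rewrite mulf_eq0 gt_eqF ?weight_gt0 //= => /eqP l0.
    by rewrite hAP // l0 scale0r.
  have := derive_locally_cst ht0 hAP0 (is_derive_mulmx A (derive_P hX t0)).
  rewrite -scalemxAr mulmxBr -scalemxAr hAP0 // scaler0 subr0 => /eqP.
  rewrite scaler_eq0 (negbTE (rN0 _)) /= => /eqP hT0.
  have [K K0 hK] := dot_mulmx_bounded A.
  by apply: (linear_invariant hX K0 _ (hAP0 _ ht0) hT0) => t; exact: hK.
right.
have lN0 s : s \in `]t1, t2[ -> l s != 0.
  move=> hs; apply: contra_neq VN0 => l0.
  by rewrite -(hVc s hs) V_inside // l0 mulr0.
have ha0 s : s \in `]t1, t2[ -> a s = 0.
  move=> hs; apply: (mulfI (lN0 s hs)).
  by rewrite mulr0 -dotZr -hAP // dotC dot_mulmx_anti0.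
have hr0 s : s \in `]t1, t2[ -> rho s + alpha * (1 - rho s) = 0.
  move=> hs; have := derive_locally_cst hs ha0 (derive_a hA hX s).
  by rewrite ha0 // !mulr0 subr0.
have hcr := circle_radius hA hX (ha0 _ ht0) (hr0 _ ht0).
have hr t : rho t = rho t0.
  have aN1 : 1 - alpha != 0 by rewrite gt_eqF // subr_gt0 (lt_trans alpha_lt0).
  by have [_ h1] := hcr t; have h2 := hr0 _ ht0; apply: (mulfI aN1); lra.
have hl s : s \in `]t1, t2[ -> l s = l t0.
  move=> hs; have wN0 : weight (rho t0) != 0 by rewrite gt_eqF // weight_gt0.
  by apply: (mulfI wN0); rewrite -V_inside // -{1}(hr s) -V_inside // !hVc.
have hP0 := hAP _ ht0; have lam0 := lN0 _ ht0.
have hTd := derive_T hX t0.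
set lam := l t0 in hl hP0 lam0 hTd; rewrite (ha0 _ ht0) hP0 mulr0 add0r addrK in hTd.
exists lam, (lam * alpha / rho t0), (rho t0).
have hnu : rho t0 * (lam * alpha / rho t0) = lam * alpha by rewrite mulrC divfK.
split=> //; first exact: hr0.
have hAPc s : s \in `]t1, t2[ -> A *m P s - lam *: T s = 0.
  by move=> hs; rewrite hAP // hl // subrr.
(* Differentiating [A P = lam T] gives [rho A T = lam alpha P]. *)
have := derive_locally_cst ht0 hAPc (is_deriveB
  (is_derive_mulmx A (derive_P hX t0)) (is_derive_scale (is_derive_cst lam t0 1) hTd)).
rewrite (ha0 _ ht0) scale0r subr0 scale0r add0r -scalemxAr /cst scalerA => /eqP.
rewrite subr_eq0 => /eqP hAT.
have hAT0 : A *m T t0 = (lam * alpha / rho t0) *: P t0.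
  by apply: (scalerI (rN0 t0)); rewrite hAT scalerA hnu.
have hc := circle_plane hX (fun t => (hcr t).1) hr hnu hP0 hAT0.
by move=> t; have [] := hc t; split=> //; exact: (hcr t).1.
Qed.

Lemma kernel_V : kernel_orbit -> forall t, V t = 0.
Proof. by move=> h t; rewrite V_inside // (h t).1 dot0l mulr0. Qed.

Lemma circle_V mu nu rho0 : circle_orbit mu nu rho0 ->
  forall t, V t = weight rho0 * mu.
Proof.
move=> [_ _ _ h] t; rewrite V_inside //; case: (h t) => _ -> -> _.
by rewrite dotZl (orbit_T1 hX) mulr1.
Qed.

End Lyapunov.

(** * Change of parameter *)

Section Reparametrization.
Context {R : realType}.
Implicit Types (f w sigma tau : R -> R).

Lemma derive_reflect f (df x : R) : is_derive (- x) 1 f df ->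
  is_derive x 1 (fun y => - f (- y)) df.
Proof.
move=> h; apply: eq_is_derive (is_deriveN (is_derive1_comp h (is_deriveNid x 1))) => //.
by rewrite mulrN1 opprK.
Qed.

Lemma antiderivative_above f (b : R) : continuous f ->
  exists G : R -> R, forall x : R, b < x -> is_derive x 1 G (f x).
Proof.
move=> hf; exists (fun x => \int[lebesgue_measure]_(t in `[b, x]) f t)%R => x hx.
have x1 : x < x + 1 by rewrite ltrDl.
have hi : lebesgue_measure.-integrable `[b, x + 1] (EFin \o f).
  by apply: continuous_compact_integrable;
    [exact: segment_compact|exact: continuous_subspaceT].
have [h1 h2] := continuous_FTC1_closed x1 hi hx (hf x).
by split; [exact: h1|rewrite -derive1E h2].
Qed.

(** The fundamental theorem gives antiderivatives on half-lines [x > -1] and, by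
    reflection, [x < 1]; they are glued at [0]. *)
Lemma antiderivative f : continuous f ->
  exists F : R -> R, forall x : R, is_derive x 1 F (f x).
Proof.
move=> hf; have [G hG] := antiderivative_above (-1) hf.
have hfN : continuous (fun x => f (- x)).
  by move=> x; apply: continuous_comp; [exact: opp_continuous|exact: hf].
have [H hH] := antiderivative_above (-1) hfN.
pose Hm (x : R) := - H (- x).
have hHm (x : R) : x < 1 -> is_derive x 1 Hm (f x).
  move=> hx; apply: derive_reflect; rewrite -[in f x](opprK x).
  by apply: hH; rewrite ltrN2.
have hGH (x y : R) : -1 < x -> x < y -> y < 1 -> G x - Hm x = G y - Hm y.
  move=> h1 h2 h3.
  have hd (z : R) : -1 < z -> z < 1 -> is_derive z 1 (fun z => G z - Hm z) 0.
    by move=> z1 z2; rewrite -(subrr (f z)); apply: is_deriveB; [exact: hG|exact: hHm].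
  have [z zxy|z|c _ /=] := @MVT R (fun z => G z - Hm z) (cst 0) x y h2.
  - move: zxy; rewrite in_itv => /andP[z1 z2].
    by apply: hd; [exact: lt_trans z1|exact: lt_trans z2 _].
  - apply: derivable_within_continuous => u; rewrite in_itv => /andP[u1 u2].
    have [] := hd u _ _ => //; [exact: lt_le_trans u1|exact: le_lt_trans u2 _].
  - by rewrite mul0r => /eqP; rewrite subr_eq0 => /eqP ->.
pose F (x : R) := if x < 0 then Hm x - Hm 0 else G x - G 0.
exists F => x.
have hsub (K : R -> R) (c d : R) : is_derive x 1 K d -> is_derive x 1 (fun y => K y - c) d.
  by move=> hK; rewrite -(subr0 d); exact: is_deriveB.
have [x0|x0] := ltP x 0.
  apply: (near_eq_is_derive _ (hsub Hm (Hm 0) _ (hHm x _))); last exact: lt_trans x0 _.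
  by near=> y; rewrite /F ifT //; near: y; exact: lt_nbhsl.
apply: (near_eq_is_derive _ (hsub G (G 0) _ (hG x _))); last exact: lt_le_trans x0.
near=> y; rewrite /F; case: ltP => // y0.
have y1 : -1 < y by near: y; apply: lt_nbhsr; exact: lt_le_trans x0.
by have := hGH y 0 y1 y0 ltr01; lra.
Unshelve. all: by end_near. Qed.

(** A clock running at speed [1 / w] is unbounded when [w] itself grows at rate at
    most [1 / w]: as long as the clock stays below [s], the slowdown [w] is bounded
    after time [0] by [s - sigma 0 + w 0], since [sigma - w] is nondecreasing. *)
Lemma clock_unbounded sigma w (dw : R -> R) : (forall t, 0 < w t) ->
  (forall t : R, is_derive t 1 sigma (w t)^-1) ->
  (forall t : R, is_derive t 1 w (dw t)) -> (forall t, dw t <= (w t)^-1) ->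
  forall s, exists t, s <= sigma t.
Proof.
move=> w0 hs hw hdw s; apply: contrapT => /forallNP hN.
have {}hN t : sigma t < s by rewrite ltNge; apply/negP.
have hm : {homo (fun t => sigma t - w t) : x y / x <= y}.
  apply: (der_ge0_homo (fun t => is_deriveB (hs t) (hw t))) => t.
  by rewrite subr_ge0.
pose M := s - sigma 0 + w 0.
have M0 : 0 < M by rewrite addr_gt0 // subr_gt0.
have hM t : 0 <= t -> w t <= M.
  by move=> t0; have := hm _ _ t0; have := hN t; rewrite /M; lra.
pose t1 := M * (s - sigma 0).
have t10 : 0 <= t1 by rewrite mulr_ge0 ?ltW // subr_gt0.
have [|c hc] := @MVT_segment R sigma (fun t => (w t)^-1) 0 t1 t10 (fun z _ => hs z).
  exact/continuous_subspaceT/(is_derive_continuous hs).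
rewrite subr0 => h; have := hN t1.
suff : s - sigma 0 <= (w c)^-1 * t1 by rewrite -h; lra.
move: hc; rewrite in_itv => /andP[c0 _].
by rewrite mulrC ler_pdivlMr // mulrC ler_wpM2r ?hM // ltW // subr_gt0.
Qed.

Lemma clock_surjective sigma w (dw : R -> R) : (forall t, 0 < w t) ->
  (forall t : R, is_derive t 1 sigma (w t)^-1) ->
  (forall t : R, is_derive t 1 w (dw t)) -> (forall t, `|dw t| <= (w t)^-1) ->
  forall s, exists t, sigma t = s.
Proof.
move=> w0 hs hw hdw s.
have [t2 ht2] : exists t, s <= sigma t.
  apply: (clock_unbounded w0 hs hw) => t; exact: le_trans (ler_norm _) (hdw t).
have [t1 ht1] : exists t, - s <= - sigma (- t).
  apply: (@clock_unbounded _ (fun t => w (- t)) (fun t => - dw (- t))) => // t.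
  - exact: derive_reflect (hs (- t)).
  - apply: eq_is_derive (is_derive1_comp (hw (- t)) (is_deriveNid t 1)) => //.
    by rewrite mulrN1.
  - by apply: le_trans (ler_norm _) _; rewrite normrN.
rewrite lerN2 in ht1.
have hmono : {homo sigma : x y / x <= y}.
  by apply: (der_ge0_homo hs) => t; rewrite invr_ge0 ltW.
have [t12|/ltW t21] := leP (- t1) t2; last first.
  by exists t2; apply/eqP; rewrite eq_le ht2 andbT (le_trans _ ht1) // hmono.
have [||c _ <-] := @IVT R sigma _ _ s t12; last by exists c.
  exact/continuous_subspaceT/(is_derive_continuous hs).
by rewrite ge_min le_max ht1 ht2 orbT.
Qed.

(** The autonomous equation [tau' = w(tau)] has a global solution: the inverse of
    an antiderivative of [1 / w]. *)
Lemma time_change w (dw : R -> R) : (forall t, 0 < w t) ->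
  (forall t : R, is_derive t 1 w (dw t)) -> (forall t, `|dw t| <= (w t)^-1) ->
  exists tau : R -> R, forall s : R, is_derive s 1 tau (w (tau s)).
Proof.
move=> w0 hw hdw.
have wN0 t : w t != 0 by rewrite gt_eqF.
have hc : continuous (fun t => (w t)^-1).
  by move=> t; apply: continuousV => //; exact: (is_derive_continuous hw).
have [sigma hs] := antiderivative hc.
have hsurj := clock_surjective w0 hs hw hdw.
pose tau s := sval (cid (hsurj s)).
have tauK s : sigma (tau s) = s by rewrite /tau; case: cid.
have hincr : {homo sigma : x y / x < y}.
  move=> x y xy; rewrite -subr_gt0.
  have [|c _ ->] := @MVT R sigma (fun t => (w t)^-1) x y xy (fun z _ => hs z).
    exact/continuous_subspaceT/(is_derive_continuous hs).
  by rewrite mulr_gt0 ?invr_gt0 // subr_gt0.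
have sigmaK t : tau (sigma t) = t.
  have h := tauK (sigma t).
  by case: (ltgtP (tau (sigma t)) t) => // /hincr; rewrite h ltxx.
exists tau => s.
rewrite -{1}(tauK s) -[w _]invrK; apply: is_derive_inverse.
- by near=> t; exact: sigmaK.
- by near=> t; exact: (is_derive_continuous hs).
- by rewrite invr_neq0.
Unshelve. all: by end_near. Qed.

End Reparametrization.

(** * The soliton of an orbit *)

Section OrbitToSoliton.
Context {R : realType} {n : nat} (alpha : R) (A : 'M[R]_n) (P T : R -> 'cV[R]_n).
Context (hX : is_flow_orbit alpha A P T).
Local Notation rho t := (1 - dot (P t) (P t)).
Context (rho_gt0 : forall t, 0 < rho t).

(** [w = (1 - |P|^2)^(-1/2) = (1 + |C|^2)^(1/2)] *)
Local Notation w t := (Num.sqrt (rho t))^-1.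

Lemma derive_w (t : R) : is_derive t 1 (fun t => w t) (dot (P t) (T t) * (w t)^-1).
Proof.
have s0 : 0 < Num.sqrt (rho t) by rewrite sqrtr_gt0.
have sN0 : Num.sqrt (rho t) != 0 by rewrite gt_eqF.
have h := @is_derive1_comp R Num.sqrt (fun s => rho s) t _ _
  (is_derive1_sqrt (rho_gt0 t)) (derive_rho hX t).
apply: eq_is_derive (is_deriveV (f := Num.sqrt \o (fun s => rho s)) sN0 h) => //.
have hr := sqr_sqrtr (ltW (rho_gt0 t)); rewrite /GRing.scale /=.
move: (Num.sqrt (rho t)) sN0 hr => q qN0 <-.
by field.
Qed.

Lemma orbit_time_change : exists tau : R -> R, forall s : R,
  is_derive s 1 tau (w (tau s)).
Proof.
have w0 t : 0 < w t by rewrite invr_gt0 sqrtr_gt0.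
apply: (time_change w0 derive_w) => t.
rewrite normrM [X in _ * X]ger0_norm ?invrK ?sqrtr_ge0 //.
by rewrite ler_piMl ?sqrtr_ge0 // (orbit_a_norm hX).
Qed.

Context (tau : R -> R) (htau : forall s : R, is_derive s 1 tau (w (tau s))).

(** The curve [C = (1 - |P|^2)^(-1/2) P] in the parameter [s] given by
    [t = tau s]; it is parametrized by arc length when [tau' = w(tau)]. *)
Definition soliton_curve (s : R) := w (tau s) *: P (tau s).
Local Notation C := soliton_curve.

Lemma w_sqr t : (w t) ^+ 2 = (rho t)^-1.
Proof. by rewrite exprVn sqr_sqrtr // ltW. Qed.

Lemma soliton_curve_norm s : Num.sqrt (1 + enorm (C s) ^+ 2) = w (tau s).
Proof.
have h : 1 + enorm (C s) ^+ 2 = (w (tau s)) ^+ 2.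
  rewrite enorm_sqr dotZl dotZr mulrA -expr2 w_sqr.
  have r0 : rho (tau s) != 0 by rewrite gt_eqF.
  by field.
by rewrite h sqrtr_sqr ger0_norm // invr_ge0 sqrtr_ge0.
Qed.

Lemma derive_soliton_curve (s : R) : is_derive s 1 C (T (tau s)).
Proof.
have h := is_derive_comp_col (htau s)
  (is_derive_scale (derive_w (tau s)) (derive_P hX (tau s))).
apply: eq_is_derive h => //.
have w0 : w (tau s) != 0 by rewrite gt_eqF // invr_gt0 sqrtr_gt0.
have hwr : w (tau s) * w (tau s) * rho (tau s) = 1.
  by rewrite -expr2 w_sqr mulVf // gt_eqF.
rewrite scalerDr !scalerA mulrCA divff // hwr mulr1 scale1r.
by rewrite addrC subrK.
Qed.

Lemma derive1_soliton_curve : derive1 C = fun s => T (tau s).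
Proof.
by apply/funext => s; rewrite derive1E; case: (derive_soliton_curve s).
Qed.

Lemma soliton_curve_soliton : is_soliton alpha A C.
Proof.
move=> s; rewrite derive1_soliton_curve; split.
- by case: (derive_soliton_curve s).
- by case: (hX (tau s)).
have h := is_derive_comp_col (htau s) (derive_T hX (tau s)).
apply: eq_is_derive h => //.
rewrite /orth_proj enorm_sqr (orbit_T1 hX) divr1 /C -scalemxAr dotZl.
rewrite mulmxDl mul_scalar_mx dotDl dotZl.
by rewrite -scalerA -scalerBr.
Qed.

Lemma soliton_curve_corresponds : corresponds P T C.
Proof.
exists tau => s; rewrite soliton_curve_norm derive1_soliton_curve; split=> //.
by rewrite scalerA invrK divff ?scale1r // gt_eqF // sqrtr_gt0.
Qed.

End OrbitToSoliton.

(** * Solitons in the null space of A *)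

Section Kernel.
Context {R : realType} {n : nat} (alpha : R) (A : 'M[R]_n) (P T : R -> 'cV[R]_n).
Context (hX : is_flow_orbit alpha A P T).
Local Notation rho t := (1 - dot (P t) (P t)).
Context (rho_gt0 : forall t, 0 < rho t).

Lemma rank_row_mx2 (u v : 'cV[R]_n) :
  (forall x y : R, x *: u + y *: v = 0 -> x = 0 /\ y = 0) ->
  \rank (row_mx u v : 'M[R]_(n, 2)) = 2%N.
Proof.
move=> h; have key (c : 'rV[R]_(1 + 1)) : c *m (row_mx u v)^T = 0 -> c = 0.
  rewrite tr_row_mx -[c]hsubmxK mul_row_col.
  rewrite [lsubmx c]mx11_scalar [rsubmx c]mx11_scalar !mul_scalar_mx.
  move=> /(congr1 trmx); rewrite linearD /= !linearZ /= !trmxK trmx0 => /h [-> ->].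
  by rewrite raddf0 row_mx0.
by rewrite -mxrank_tr; apply/eqP; exact: inj_row_free.
Qed.

(** A plane through the origin containing the position [p] and the velocity [q]:
    when these are parallel, any direction outside the kernel of [A] completes
    [q] to a basis. *)
Lemma exists_plane (p q : 'cV[R]_n) : A != 0 -> A *m q = 0 -> dot q q = 1 ->
  exists W : 'M[R]_(n, 2), \rank W = 2%N /\
    (exists c, p = W *m c) /\ (exists c, q = W *m c).
Proof.
move=> A0 Aq hq.
have q0 : q != 0.
  by apply/eqP => q0; move: hq; rewrite q0 dot0l => /eqP; rewrite eq_sym oner_eq0.
have hW v x y : exists c : 'cV[R]_2, x *: q + y *: v = (row_mx q v : 'M[R]_(n, 2)) *m c.
  exists (col_mx x%:M y%:M : 'cV[R]_(1 + 1)).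
  by rewrite (mul_row_col q v x%:M y%:M) !mul_mx_scalar.
have hqW v : exists c : 'cV[R]_2, q = (row_mx q v : 'M[R]_(n, 2)) *m c.
  by have := hW v 1 0; rewrite scale1r scale0r addr0.
have [hp|hp] := eqVneq (p - dot p q *: q) 0.
  have [j hj] : exists j, A *m delta_mx j 0 != 0 :> 'cV[R]_n.
    apply: contrapT => /forallNP h; case/negP: A0; apply/eqP/matrixP => i j.
    have /negP := h j; rewrite negbK => /eqP /matrixP /(_ i 0).
    by rewrite -colE !mxE.
  exists (row_mx q (delta_mx j 0)); split; last first.
    split=> //; have := hW (delta_mx j 0) (dot p q) 0; rewrite scale0r addr0.
    by move/eqP: hp; rewrite subr_eq0 => /eqP <-.
  apply: rank_row_mx2 => x y hxy.
  have y0 : y = 0.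
    have := congr1 (mulmx A) hxy; rewrite mulmxDr -!scalemxAr Aq scaler0 add0r mulmx0.
    by move=> /eqP; rewrite scaler_eq0 (negbTE hj) orbF => /eqP.
  split=> //; move: hxy; rewrite y0 scale0r addr0 => /eqP.
  by rewrite scaler_eq0 (negbTE q0) orbF => /eqP.
set e := p - dot p q *: q in hp.
have heq : dot e q = 0 by rewrite /e !dot_linE hq; ring.
exists (row_mx q e); split; last first.
  split=> //; have := hW e (dot p q) 1; rewrite scale1r {2}/e.
  by rewrite addrC subrK.
apply: rank_row_mx2 => x y hxy.
have x0 : x = 0.
  have := congr1 (fun v => dot v q) hxy.
  by rewrite dotDl !dotZl heq hq mulr0 addr0 mulr1 dot0l.
split=> //; move: hxy; rewrite x0 scale0r add0r => /eqP.
by rewrite scaler_eq0 (negbTE hp) orbF => /eqP.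
Qed.

Lemma kernel_planar : A != 0 -> kernel_orbit A P T ->
  exists W : 'M[R]_(n, 2), \rank W = 2%N /\ forall t, exists c, P t = W *m c.
Proof.
move=> A0 hk.
have [W [rW [hp hq]]] := exists_plane (P 0) A0 (hk 0).2 (orbit_T1 hX 0).
exists W; split=> //.
(* A matrix whose kernel is the plane spanned by the columns of [W]. *)
pose B := (cokermx W^T)^T.
have hB (v : 'cV[R]_n) : (exists c, v = W *m c) <-> B *m v = 0.
  split=> [[c ->]|/(congr1 trmx)].
    apply: trmx_inj; rewrite trmx0 !trmx_mul trmxK -mulmxA mulmx_coker.
    by rewrite mulmx0.
  rewrite trmx_mul trmxK trmx0 => /eqP; rewrite -submxE => /submxP [D hD].
  by exists D^T; apply: trmx_inj; rewrite hD trmx_mul trmxK.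
have h := @linear_invariant _ _ _ _ _ _ hX B 0 0 (lexx 0) _
  ((hB _).1 hp) ((hB _).1 hq).
move=> t; apply/hB; apply: (h _ t).1 => s.
by rewrite (hk s).1 mulmx0 dot0l mul0r.
Qed.

Lemma kernel_abresch_langer (tau : R -> R) : A != 0 -> kernel_orbit A P T ->
  (forall s : R, is_derive s 1 tau (Num.sqrt (rho (tau s)))^-1) ->
  is_abresch_langer alpha A (soliton_curve P tau).
Proof.
move=> A0 hk htau.
have hAC s : A *m soliton_curve P tau s = 0.
  by rewrite -scalemxAr (hk _).1 scaler0.
split=> //.
  move=> s; have [h1 h2] := soliton_curve_soliton hX rho_gt0 htau s.
  by rewrite mulmxDl hAC -(mul0mx _ (soliton_curve P tau s)) -mulmxDl.
have [W [rW hW]] := kernel_planar A0 hk; exists W; split=> // s.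
have [c hc] := hW (tau s); exists ((Num.sqrt (rho (tau s)))^-1 *: c).
by rewrite -scalemxAr -hc.
Qed.

End Kernel.

(** * Circles *)

Section Circle.
Context {R : realType} {n : nat}.

Lemma cos_sin_surj (x y : R) : x ^+ 2 + y ^+ 2 = 1 ->
  exists theta, x = cos theta /\ y = sin theta.
Proof.
move=> h; have hx : -1 <= x <= 1.
  by rewrite -ler_norml -(@expr_le1 _ 2) // real_normK ?num_real // -h lerDl sqr_ge0.
have hs : sin (acos x) ^+ 2 = y ^+ 2.
  by have := cos2Dsin2 (acos x); rewrite acosK // -h; lra.
move: hs => /eqP; rewrite eqf_sqr => /orP[/eqP hs|/eqP hs].
  by exists (acos x); rewrite acosK // hs.
by exists (- acos x); rewrite cosN sinN acosK // hs opprK.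
Qed.

(** A left eigenvector of [i A] for [Omega] is [x^T + (i / Omega) x^T A]. *)
Lemma frequency_of_square (A : 'M[R]_n) (Omega : R) (x : 'cV[R]_n) :
  A^T = - A -> 0 < Omega -> x != 0 -> freq_space A Omega x ->
  is_frequency A Omega.
Proof.
move=> hA hO x0 hx; split=> //; apply/eigenvalueP.
pose r := real_complex R.
have hxA : x^T *m A *m A = - Omega ^+ 2 *: x^T.
  have : A *m (A *m x) = - (Omega ^+ 2 *: x).
    apply/eqP; rewrite -addr_eq0 mulmxA -mul_scalar_mx -mulmxDl.
    by apply/eqP.
  move=> /(congr1 trmx); rewrite !trmx_mul hA -scaleNr linearZ /=.
  by rewrite !mulmxN mulNmx opprK.
have hRe (u w : R) : r u + 'i%C * r w = 0 -> u = 0.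
  by move=> /(congr1 (@complex.Re R)) /=; rewrite mul0r mulr0 subr0 addr0.
have ON0 : r Omega != 0 by rewrite fmorph_eq0 gt_eqF.
exists (map_mx r x^T + ('i%C / r Omega) *: map_mx r (x^T *m A)); last first.
  apply/eqP => /matrixP h; case/eqP: x0; apply/matrixP => i j; rewrite ord1.
  have := h 0 i; rewrite 6!mxE -fmorphV -mulrA -rmorphM [in X in _ = X -> _]mxE.
  by move/hRe => ->; rewrite mxE.
rewrite mulmxDl -!scalemxAr -!scalemxAl -!map_mxM hxA map_mxZ !scalerDr !scalerA.
rewrite addrC; congr (_ *: _ + _ *: _); last by rewrite mulrC divfK.
by rewrite mulrA -expr2 sqr_i mulN1r rmorphN mulrNN rmorphXn expr2 mulKf.
Qed.

Context (alpha : R) (A : 'M[R]_n) (P T : R -> 'cV[R]_n).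
Context (alpha_lt0 : alpha < 0) (hA : A^T = - A) (hX : is_flow_orbit alpha A P T).
Local Notation rho t := (1 - dot (P t) (P t)).
Context (rho_gt0 : forall t, 0 < rho t).
Context (tau : R -> R).
Context (htau : forall s : R, is_derive s 1 tau (Num.sqrt (rho (tau s)))^-1).
Local Notation C := (soliton_curve P tau).

(** The curve solves [C'' = alpha C], hence is a harmonic oscillation. *)
Lemma circle_explicit mu nu rho0 : circle_orbit alpha A P T mu nu rho0 ->
  let omega := Num.sqrt (- alpha) in
  forall s, C s = cos (omega * s) *: C 0 + (sin (omega * s) / omega) *: T (tau 0).
Proof.
move=> [_ _ _ h] omega s.
have o2 : omega ^+ 2 = - alpha by rewrite sqr_sqrtr // oppr_ge0 ltW.
have o0 : omega != 0 by rewrite gt_eqF // sqrtr_gt0 oppr_gt0.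
pose D s := C s - (cos (omega * s) *: C 0 + (sin (omega * s) / omega) *: T (tau 0)).
pose E s := T (tau s) - ((- omega * sin (omega * s)) *: C 0 + cos (omega * s) *: T (tau 0)).
suff [] : D s = 0 /\ E s = 0 by move=> /eqP; rewrite subr_eq0 => /eqP.
have ho (t : R) : is_derive t 1 (fun t => omega * t) omega.
  by apply: trigger_derive (is_deriveZ omega (is_derive_id t 1)) _; exact: mulr1.
have hcos (t : R) : is_derive t 1 (fun t => cos (omega * t)) (- omega * sin (omega * t)).
  apply: eq_is_derive (is_derive1_comp (is_derive_cos (omega * t)) (ho t)) => //.
  by ring.
have hsin (t : R) : is_derive t 1 (fun t => sin (omega * t)) (omega * cos (omega * t)).
  apply: eq_is_derive (is_derive1_comp (is_derive_sin (omega * t)) (ho t)) => //.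
  by ring.
have hsc (k dk : R -> R) (t : R) (u : 'cV[R]_n) : is_derive t 1 k (dk t) ->
    is_derive t 1 (fun t => k t *: u) (dk t *: u).
  move=> hk; apply: eq_is_derive (is_derive_scale hk (is_derive_cst u t 1)) => //.
  by rewrite scaler0 addr0.
apply: (@gronwall_pair _ _ D E E (fun t => alpha *: D t) (1 + `|alpha|) 0) => [t|t|t||].
- have h1 := hsc _ (fun t => cos (omega * t)) t (T (tau 0)) _.
  have h2 : is_derive t 1 (fun t => sin (omega * t) / omega) (cos (omega * t)).
    apply: eq_is_derive (derM (hsin t) (is_derive_cst omega^-1 t 1)) => //.
    by rewrite /cst; field.
  exact: is_deriveB (derive_soliton_curve hX rho_gt0 htau t)
    (is_deriveD (hsc _ (fun t => - omega * sin (omega * t)) t (C 0) (hcos t)) (h1 _ h2)).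
- have hT := is_derive_comp_col (htau t) (derive_T hX (tau t)).
  have h1 := hsc _ (fun t => - omega * (omega * cos (omega * t))) t (C 0)
    (is_deriveZ (- omega) (hsin t)).
  have h2 := hsc _ (fun t => - omega * sin (omega * t)) t (T (tau 0)) (hcos t).
  apply: eq_is_derive (is_deriveB hT (is_deriveD h1 h2)) => //.
  have [ha _ hP _] := h (tau t).
  rewrite ha hP dotZl (orbit_T1 hX) mulr0 add0r mulr1 addrK /D /soliton_curve.
  have al : alpha = - (omega * omega) by rewrite -expr2 o2 opprK.
  apply/matrixP => i j; rewrite !mxE al.
  by move: (Num.sqrt _)^-1 (Num.sqrt _)^-1 => u v; field.
- rewrite dotZr (dotC (E t)) -[X in X + _]mul1r -mulrDl normrM.
  have := dot_norm_le (D t) (E t); have := dot_ge0 (D t); have := dot_ge0 (E t).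
  move=> e0 d0 h1; apply: ler_pM => //.
    by apply: le_trans (ler_normD _ _) _; rewrite normr1.
  by have := normr_ge0 (dot (D t) (E t)); lra.
- by rewrite /D mulr0 cos0 sin0 mul0r scale1r scale0r addr0 subrr.
- by rewrite /E mulr0 cos0 sin0 mulr0 scale1r scale0r add0r subrr.
Qed.

Lemma circle_trivial mu nu rho0 : circle_orbit alpha A P T mu nu rho0 ->
  is_trivial_circle alpha A C.
Proof.
move=> hc; have hexp := circle_explicit hc; move: (hc) => [mu0 hnu hrho h].
split; first exact (soliton_curve_soliton hX rho_gt0 htau).
set omega := Num.sqrt (- alpha) in hexp *.
have o2 : omega ^+ 2 = - alpha by rewrite sqr_sqrtr // oppr_ge0 ltW.
have o0 : 0 < omega by rewrite sqrtr_gt0 oppr_gt0.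
have r0 : 0 < rho0 by have [_ <- _ _] := h 0; exact: rho_gt0.
pose k := (Num.sqrt rho0)^-1.
have k0 : 0 < k by rewrite invr_gt0 sqrtr_gt0.
have k2 : k ^+ 2 = rho0^-1 by rewrite exprVn sqr_sqrtr // ltW.
(* [Omega^2 = - mu nu], since [A^2] acts on the plane as [mu nu]. *)
pose Omega := omega * k * `|mu|.
have O0 : 0 < Omega by rewrite !mulr_gt0 // normr_gt0.
(* The sign [eps] compares the direction of motion with the quarter turn [J]:
   [J x = eps q / omega]. *)
have [x hx] : exists x, C 0 = x by exists (C 0).
rewrite hx in hexp.
pose q := T (tau 0); pose eps := mu / `|mu|.
have eps2 : eps * eps = 1.
  by rewrite -expr2 expr_div_n real_normK ?num_real // divff // sqrf_eq0.
have hCP s : C s = k *: P (tau s).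
  by rewrite /soliton_curve /k; have [_ -> _ _] := h (tau s).
have hq : dot q q = 1 := orbit_T1 hX _.
have hxq : dot x q = 0 by rewrite -hx hCP dotZl; have [-> _ _ _] := h (tau 0); rewrite mulr0.
have hxx : dot x x = (omega ^+ 2)^-1.
  have e : dot (P (tau 0)) (P (tau 0)) = 1 - rho0.
    by have [_ <- _ _] := h (tau 0); rewrite opprB addrC subrK.
  rewrite -hx hCP dotZl dotZr mulrA -expr2 k2 e o2.
  have r0' := gt_eqF r0; have al0 := lt_eqF alpha_lt0.
  have -> : 1 - rho0 = - (rho0 / alpha).
    apply: (mulfI (negbT al0)); rewrite mulrN mulrCA divff ?al0 //; lra.
  by field; rewrite r0' al0.
have x0 : x != 0.
  apply/eqP => e; move: hxx; rewrite e dot0l => /esym/eqP.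
  by rewrite invr_eq0 expf_eq0 /= gt_eqF.
have hAx : A *m x = (k * mu) *: q.
  by rewrite -hx hCP -scalemxAr; have [_ _ -> _] := h (tau 0); rewrite scalerA.
have hJ : Omega^-1 *: (A *m x) = (eps / omega) *: q.
  rewrite hAx scalerA; congr (_ *: _); rewrite /Omega /eps.
  by field; rewrite !gt_eqF // normr_gt0.
have hF : freq_space A Omega x.
  rewrite /freq_space /= mulmxDl mul_scalar_mx -mulmxA hAx -scalemxAr.
  have [_ _ _ ->] := h (tau 0).
  have -> : P (tau 0) = k^-1 *: x by rewrite -hx hCP scalerA mulVf ?scale1r // gt_eqF.
  rewrite !scalerA -scalerDl; apply/eqP; rewrite scaler_eq0 (negbTE x0) orbF; apply/eqP.
  have -> : nu = mu * alpha / rho0 by rewrite -hnu mulrC mulKf // gt_eqF.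
  rewrite /Omega !exprMn real_normK ?num_real // o2 k2.
  by field; rewrite !gt_eqF.
exists Omega, x; split=> //; first exact: frequency_of_square hF.
have hnorm a b : dot (a *: x + (b * eps / omega) *: q) (a *: x + (b * eps / omega) *: q)
    = (a ^+ 2 + b ^+ 2) / omega ^+ 2.
  rewrite !dot_linE (dotC q x) hxq hxx hq !mulr0 addr0 add0r mulr1.
  have -> : b * eps / omega * (b * eps / omega) = (eps * eps) * b ^+ 2 / omega ^+ 2.
    by field; rewrite gt_eqF.
  by rewrite eps2; field; rewrite gt_eqF.
apply/seteqP; split=> [_ [s _ <-]|v [[a [b ->]]]].
  have hs : C s = cos (omega * s) *: x
      + (eps * sin (omega * s) * eps / omega) *: q.
    by rewrite hexp -(mulrC eps) mulrA eps2 mul1r.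
  split.
    exists (cos (omega * s)), (eps * sin (omega * s)).
    by rewrite hJ scalerA mulrA -hs.
  rewrite /enorm hs hnorm exprMn [eps ^+ 2]expr2 eps2 mul1r cos2Dsin2 mul1r.
  by rewrite -exprVn sqrtr_sqr ger0_norm // invr_ge0 ltW.
rewrite hJ scalerA mulrA => hv.
have : a ^+ 2 + (eps * b) ^+ 2 = 1.
  have := congr1 (fun z => z ^+ 2) hv; rewrite enorm_sqr hnorm -/omega exprVn.
  rewrite exprMn [eps ^+ 2]expr2 eps2 mul1r => e.
  have : (a ^+ 2 + b ^+ 2) / omega ^+ 2 * omega ^+ 2 = (omega ^+ 2)^-1 * omega ^+ 2.
    by rewrite e.
  by rewrite divfK ?mulVf // expf_eq0 /= gt_eqF.
move=> /cos_sin_surj [theta [-> hb]].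
exists (theta / omega) => //; rewrite hexp mulrC divfK ?gt_eqF //.
by rewrite -hb (mulrC eps).
Qed.

End Circle.

(** * Monotonicity of V and characterization of its constancy *)

Unset Implicit Arguments.

Theorem lemma8p3 (R : realType) (n : nat) (alpha : R) (A : 'M[R]_n)
    (halpha : alpha < 0) (hA : A^T = - A) (hA0 : A != 0)
    (P T : R -> 'cV[R]_n) (hX : is_flow_orbit alpha A P T) :
  let VX := fun t : R => V_fun alpha A (P t) (T t) in
  let VX_constant := exists c : R, forall t : R, VX t = c in
  ({homo VX : t1 t2 / t1 < t2} \/ VX_constant) /\
  (VX_constant ->
     (exists C : R -> 'cV[R]_n,
        is_trivial_soliton alpha A C /\ corresponds P T C) \/
     (forall t : R, enorm (P t) = 1)).
Proof.
move=> VX VX_constant.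
have [[t0 h0]|hN] := pselect (exists t, 1 - dot (P t) (P t) = 0).
  have hP t : enorm (P t) = 1.
    have := rho_eq0 hX h0 t => /eqP; rewrite subr_eq0 => /eqP h.
    by rewrite /enorm -h sqrtr1.
  split; right=> //; exists 0 => t.
  by rewrite /VX /V_fun hP ltxx.
have hr t : 0 < 1 - dot (P t) (P t).
  rewrite lt_neqAle (orbit_rho_ge0 hX) andbT eq_sym.
  by apply/eqP => h; apply: hN; exists t.
split.
  have [hs|] := pselect {homo VX : t1 t2 / t1 < t2}; [by left|right].
  have [[t1 [t2 [t12 hV]]]|hNV] := pselect (exists t1 t2, t1 < t2 /\ VX t1 = VX t2).
    have [hk|[mu [nu [rho0 hc]]]] := V_stationary halpha hA hX hr t12 hV.
      by exists 0 => t; exact: kernel_V.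
    by exists (weight alpha rho0 * mu) => t; apply: circle_V hc _.
  case: b => t1 t2 t12; rewrite lt_neqAle (V_homo hA hX hr (ltW t12)) andbT.
  by apply/eqP => h; apply: hNV; exists t1, t2.
move=> [c hc]; left.
have [tau htau] := orbit_time_change hX hr.
exists (soliton_curve P tau); split; last exact: soliton_curve_corresponds.
have hV01 : VX 0 = VX 1 by rewrite !hc.
have [hk|[mu [nu [rho0 hcr]]]] := V_stationary halpha hA hX hr ltr01 hV01.
  by right; exact: kernel_abresch_langer hk htau.
by left; exact: circle_trivial hcr.
Qed.
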